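(* Let $\mathbb{T}$ be a time scale, $a,b\in\mathbb{T}$ with $a<b$, $A\in\mathbb{R}$, and let $K:[a,b]^\kappa_{\mathbb{T}}\times[a,b]^{\kappa^2}_{\mathbb{T}}\times\mathbb{R}\to\mathbb{R}$ and $F:[a,b]^\kappa_{\mathbb{T}}\times\mathbb{R}^2\to\mathbb{R}$ be continuous functions. Assume that $$|F(t,x,y)|\le Bw(\max\{|x|,|y|\})+C,\qquad |K(t,s,x)|\le D\tilde w(|x|),$$ where $B,C,D$ are positive constants and $w,\tilde w\in C(\mathbb{R}_0^+,\mathbb{R}_0^+)$ are nondecreasing functions with $w(x)>0$ and $\tilde w(x)>0$ for $x>0$ such that, with $M=(b-a)D$ and $$G(x)=\int_1^x\frac{1}{w(\max\{s,M\tilde w(s)\})}ds,\quad x>0,$$ one has $\lim_{x\to\infty}G(x)=\infty$. Then the integrodynamic equation $$x^\Delta(t)=F\left(t,x(t),\int_a^tK[t,\tau,x(\tau)]\Delta\tau\right),\quad x(a)=A,\quad t\in[a,b]^\kappa_{\mathbb{T}},$$ has a solution $x\in C^1([a,b]_{\mathbb{T}},\mathbb{R})$.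
   Context: $\mathbb{R}_0^+=[0,\infty)$. A time scale is a nonempty closed subset of $\mathbb{R}$; $[a,b]_{\mathbb{T}}=[a,b]\cap\mathbb{T}$; $\sigma(t)=\inf\{s\in\mathbb{T}:s>t\}$, $\rho(t)=\sup\{s\in\mathbb{T}:s<t\}$. A superscript $\kappa$ removes the maximum if it is left-scattered ($\rho(t)<t$); $\kappa^2$ means twice. $x^\Delta(t)$ is the $\Delta$-derivative: for each $\varepsilon>0$, $|x(\sigma(t))-x(s)-x^\Delta(t)(\sigma(t)-s)|\le\varepsilon|\sigma(t)-s|$ for $s$ in a neighborhood of $t$. $\int_c^d f\Delta t=F(d)-F(c)$ with $F^\Delta=f$. $C^1([a,b]_{\mathbb{T}},\mathbb{R})$ is the set of $\Delta$-differentiable functions whose $\Delta$-derivative is continuous on $[a,b]^\kappa_{\mathbb{T}}$. *)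

(* Defs.v *)
From HB Require Import structures.
From mathcomp Require Import all_boot all_order all_algebra.
From mathcomp Require Import all_classical all_reals all_analysis.
Import Order.TTheory GRing.Theory Num.Theory.
Import numFieldNormedType.Exports.

Set Implicit Arguments.
Unset Strict Implicit.
Unset Printing Implicit Defensive.

Local Open Scope classical_set_scope.
Local Open Scope ring_scope.

Section TimeScale.
Context {R : realType}.
Implicit Types (S T : set R) (f x : R -> R) (c d t l v : R).

Definition time_scale T : Prop := T !=set0 /\ closed T.

(* The segment is again a time scale. All the notions below are relative to
   the time scale passed as argument, so that on a segment they only involve
   points of that segment. *)
Definition ts_itv T (a b : R) : set R := `[a, b] `&` T.

(* Convention: inf of the empty set is sup T, so a maximum t of T satisfies
   sigma T t = t (the library value of inf on the empty set is 0). *)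
Definition sigma T t : R :=
  if `[< exists s, T s /\ t < s >] then inf [set s | T s /\ t < s] else sup T.

(* Convention: sup of the empty set is inf T. *)
Definition rho T t : R :=
  if `[< exists s, T s /\ s < t >] then sup [set s | T s /\ s < t] else inf T.

Definition kappa T : set R :=
  T `\` [set t | ubound T t /\ rho T t < t].

Definition is_delta_derive T f t l : Prop :=
  forall eps : R, 0 < eps ->
    \forall s \near within T (nbhs t),
      `|f (sigma T t) - f s - l * (sigma T t - s)| <= eps * `|sigma T t - s|.

Definition is_delta_integral T f c d v : Prop :=
  exists2 Phi : R -> R,
    (forall t, kappa T t -> is_delta_derive T Phi t (f t)) &
    v = Phi d - Phi c.

Definition delta_C1 T x : Prop :=
  exists2 dx : R -> R,
    (forall t, kappa T t -> is_delta_derive T x t (dx t)) &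
    {within kappa T, continuous dx}.

End TimeScale.

(* Oriented integral from c to d: one of the two sets has measure zero. *)
Definition oriented_integral {R : realType} (f : R -> R) (c d : R) : R :=
  \int[lebesgue_measure]_(s in `[c, d]) f s
  - \int[lebesgue_measure]_(s in `[d, c]) f s.

Definition nonneg_nondecreasing_C {R : realType} (w : R -> R) : Prop :=
  [/\ {within `[0, +oo[, continuous w},
      (forall s, 0 <= s -> 0 <= w s),
      (forall s t, 0 <= s -> s <= t -> w s <= w t) &
      (forall s, 0 < s -> 0 < w s)].

(* Main.v *)
Require Import Defs.
From HB Require Import structures.
From mathcomp Require Import all_boot all_order all_algebra.
From mathcomp Require Import all_classical all_reals all_analysis.
From mathcomp Require Import measurable_realfun ring lra.
Import Order.TTheory GRing.Theory Num.Theory.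
Import numFieldNormedType.Exports.

Local Open Scope classical_set_scope.
Local Open Scope ring_scope.

(** A continuous function f on the segment [a, b] of the time scale is
    encoded by the function s |-> f (floor s) on the real line, where floor s is
    the last point of the time scale up to s. Its Lebesgue integral over
    [u, v[ is the delta integral of f from u to v: a gap of the time scale
    contributes the value at its left end times its length. The lemma
    is_delta_derive_integral turns this remark into the fundamental theorem of
    calculus on a time scale, and reduces the theorem to finding a continuous
    x with
      x t = A + \int_a^t F (p, x p, \int_a^p K (p, q, x q)) ds,
    where p is the floor of s and q the floor of the inner variable. Time scales
    then intervene only through floor s <= s, which makes the equation causal.

    Such an equation is solved by delaying the upper bound of the outer integral
    by h > 0. The delayed equation determines its solution step by step, on
    intervals of length h (tonelli_fixpoint). These solutions are
    equi-Lipschitz and bounded, so a subsequence converges pointwise as h tends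
    to 0 (equi_lipschitz_subsequence), and dominated convergence shows that the
    limit solves the equation without delay (tonelli_solution).

    The growth condition provides the a priori bound. A solution with
    |x| <= rho up to time t grows at speed at most
      H rho = B w (max rho (M wt rho)) + C,
    hence needs a time at least 1 / H (rho + 1) to go from level rho to level
    rho + 1. Since G tends to infinity, the sum of the 1 / H (rho + k) diverges
    (growth_time_unbounded), so only finitely many levels, fixed in advance, can
    be crossed before time b. The sets of functions that respect these crossing
    times are stable under the delayed operator (tonelli_level_solution).

    Having a bound r beforehand allows one to truncate the last arguments of F
    and K, and to extend the truncated functions, by the Tietze theorem, to
    bounded continuous functions on the whole space (bounded_extension). The
    solution never leaves the region where nothing has been changed. *)

(** * Integrals of bounded measurable functions with a varying upper bound *)

Section RunningIntegral.
Context {R : realType}.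
Local Notation mu := (@lebesgue_measure R).
Implicit Types (g : R -> R) (a c e s t u v L : R).

Definition running_integral a g t : R := \int[mu]_(s in `[a, t[) g s.

Lemma bounded_integrable_itv g L u v :
  measurable_fun [set: measurableTypeR R] g -> (forall s, `|g s| <= L) ->
  mu.-integrable `[u, v[ (EFin \o g).
Proof.
move=> mg gL; apply: measurable_bounded_integrable.
- exact: measurable_itv.
- have := lebesgue_measure_itv `[u, v[%R; rewrite /= => ->.
  by case: ifPn => // _; rewrite -EFinB ltry.
- exact: measurable_funTS.
- exists L; split; first exact: num_real.
  by move=> M LM s _; exact: le_trans (gL s) (ltW LM).
Qed.

Lemma fine_measure_itv u v : u <= v -> fine (mu `[u, v[) = v - u.
Proof.
move=> uv; rewrite lebesgue_measure_itv/= lte_fin.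
by case: ltgtP uv => // -> _; rewrite subrr.
Qed.

Lemma running_integralB a g L u v :
  measurable_fun [set: measurableTypeR R] g -> (forall s, `|g s| <= L) ->
  a <= u -> u <= v ->
  running_integral a g v - running_integral a g u =
  \int[mu]_(s in `[u, v[) g s.
Proof.
move=> mg gL au uv; rewrite /running_integral.
have -> : `[a, v[%classic = `[a, u[%classic `|` `[u, v[%classic.
  by rewrite -itv_bndbnd_setU// bnd_simp.
rewrite Rintegral_setU//; first by rewrite addrAC subrr add0r.
- rewrite -itv_bndbnd_setU ?bnd_simp//.
  exact: bounded_integrable_itv mg gL.
- apply/disj_setPS => s []/=; rewrite !in_itv/= => /andP[_ su] /andP[us _].
  by move: su; rewrite ltNge us.
Qed.

Lemma running_integral_eq0 a g t : t <= a -> running_integral a g t = 0.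
Proof.
move=> ta; rewrite /running_integral set_itv_ge ?Rintegral_set0//.
by rewrite bnd_simp -leNgt.
Qed.

Lemma Rintegral_itv_approx g L c e u v :
  measurable_fun [set: measurableTypeR R] g -> (forall s, `|g s| <= L) -> u <= v ->
  (forall s, u <= s < v -> `|g s - c| <= e) ->
  `|\int[mu]_(s in `[u, v[) g s - c * (v - u)| <= e * (v - u).
Proof.
move=> mg gL uv ge.
have ig := @bounded_integrable_itv g L u v mg gL.
have ic k : mu.-integrable `[u, v[ (EFin \o cst k).
  exact: (@bounded_integrable_itv (cst k) `|k|).
have cE k : k * (v - u) = \int[mu]_(s in `[u, v[) cst k s.
  by rewrite Rintegral_cst ?fine_measure_itv.
have key s : `[u, v[%classic s -> c - e <= g s <= c + e.
  by rewrite /= in_itv/= => /ge; rewrite ler_distl.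
rewrite ler_distl -mulrBl -mulrDl !cE; apply/andP; split;
  by apply: le_Rintegral => // s /key/andP[].
Qed.

(** Below a the integral vanishes, so the Lipschitz bound holds on the whole
    line; this is what lets the delayed upper bound fall before a. *)
Lemma running_integral_lipschitz a g L s t :
  measurable_fun [set: measurableTypeR R] g -> (forall s, `|g s| <= L) ->
  `|running_integral a g t - running_integral a g s| <= L * `|t - s|.
Proof.
move=> mg gL; have L0 : 0 <= L := le_trans (normr_ge0 _) (gL 0).
wlog st : s t / s <= t => [hw|].
  have [/hw//|/ltW/hw] := leP s t.
  by rewrite distrC (distrC s).
have base u v : a <= u -> u <= v ->
    `|running_integral a g v - running_integral a g u| <= L * (v - u).
  move=> au uv; rewrite (running_integralB a g L)//.
  have := @Rintegral_itv_approx g L 0 L u v mg gL uv.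
  by rewrite mul0r subr0; apply => r _; rewrite subr0.
rewrite (ger0_norm (_ : 0 <= t - s)) ?subr_ge0//.
have [as_|/ltW sa] := leP a s; first exact: base.
rewrite (running_integral_eq0 a g s)//.
have [at_|/ltW ta] := leP a t; last first.
  by rewrite running_integral_eq0// subrr normr0 mulr_ge0// subr_ge0.
rewrite -(running_integral_eq0 a g a)//; apply: le_trans (base a t _ _) _ => //.
by rewrite ler_wpM2l// lerD2l lerN2.
Qed.

(** The Lipschitz bound, uniform in n, handles the moving end point, and
    dominated convergence handles the moving integrand. *)
Lemma running_integral_cvg a (gn : nat -> R -> R) g L (tn : nat -> R) t :
  (forall n, measurable_fun [set: measurableTypeR R] (gn n)) ->
  (forall n s, `|gn n s| <= L) ->
  measurable_fun [set: measurableTypeR R] g ->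
  (forall s, gn n s @[n --> \oo] --> g s) ->
  tn n @[n --> \oo] --> t ->
  running_integral a (gn n) (tn n) @[n --> \oo] --> running_integral a g t.
Proof.
move=> mgn gnL mg gng tnt.
have intg : running_integral a (gn n) t @[n --> \oo] --> running_integral a g t.
  have gL s : `|g s| <= L.
    apply: (closed_cvg (fun y => y <= L) (@closed_le _ L) _ _ (cvg_norm (gng s))).
    by near=> n; exact: gnL.
  have := @dominated_convergence _ _ _ mu `[a, t[%classic (measurable_itv _)
    (fun n => EFin \o gn n) (EFin \o g) (cst L%:E).
  case.
  - move=> n; apply/measurable_EFinP; exact: measurable_funTS.
  - apply/measurable_EFinP; exact: measurable_funTS.
  - by apply: aeW => s _; apply: cvg_EFin; [near=> n|exact: gng].
  - exact: (@bounded_integrable_itv (cst L) `|L|).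
  - by apply: aeW => s n _ /=; rewrite lee_fin.
  move=> _ _ /= cvgI; rewrite /running_integral /Rintegral.
  apply: fine_cvg; rewrite fineK//.
  by apply: integrable_fin_num => //; exact: bounded_integrable_itv mg gL.
have L0 : 0 <= L := le_trans (normr_ge0 _) (gnL 0%N 0).
have diff0 : running_integral a (gn n) (tn n) - running_integral a (gn n) t
    @[n --> \oo] --> 0.
  apply/norm_cvg0P; apply: (@squeeze_cvgr _ _ _ _ (cst 0) (fun n => L * `|tn n - t|)).
  - near=> n; rewrite /= normr_ge0/=; exact: running_integral_lipschitz.
  - exact: cvg_cst.
  - rewrite -[X in _ --> X](mulr0 L); apply: cvgMr.
    by apply/norm_cvg0P; apply/subr_cvg0.
rewrite -[X in _ --> X]add0r; apply: cvg_trans (cvgD diff0 intg).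
by apply: near_eq_cvg; apply: nearW => n; exact: subrK.
Unshelve. all: by end_near.
Qed.

End RunningIntegral.

(** * Time scales: jump operator, floor, fundamental theorem *)

Section TimeScaleFacts.
Context {R : realType}.
Implicit Types (S E : set R) (a c e s t u v L : R).

Lemma closure_inf E : E !=set0 -> has_lbound E -> closure E (inf E).
Proof.
move=> E0 lbE B /nbhs_ballP[e /= e0 Be].
have [r Er re] := inf_adherent e0 (conj E0 lbE).
exists r; split => //; apply: Be.
by rewrite /ball/= distrC ger0_norm ?subr_ge0 ?ge_inf// ltrBlDl.
Qed.

Lemma closure_subset_closed E S : closed S -> E `<=` S -> closure E `<=` S.
Proof.
by move=> clS ES; rewrite [X in _ `<=` X](closure_id S).1//; exact: closure_subset.
Qed.

Lemma sigmaP S t : closed S -> has_ubound S -> S t ->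
  [/\ S (sigma S t), t <= sigma S t &
      forall s, S s -> t < s -> sigma S t <= s].
Proof.
move=> clS ubS St; rewrite /sigma.
case: asboolP => [exs|nexs].
  have lbE : has_lbound [set s | S s /\ t < s] by exists t => s [_ /ltW].
  split.
  - apply: (closure_subset_closed [set s | S s /\ t < s] S clS).
      by move=> s [].
    exact: closure_inf.
  - by apply: lb_le_inf => // s [_ /ltW].
  - by move=> s Ss ts; apply: ge_inf.
split.
- by apply: (closure_subset_closed S S clS _ _ (closure_sup _ ubS)); last exists t.
- exact: ub_le_sup.
- by move=> s Ss ts; case: nexs; exists s.
Qed.

Lemma kappa_sub S : kappa S `<=` S. Proof. by move=> t []. Qed.

Lemma kappa_lt S u v : S u -> S v -> u < v -> kappa S u.
Proof.
by move=> Su Sv uv; split => //= -[/(_ v Sv)]; rewrite leNgt uv.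
Qed.

(** Removing a left-scattered maximum m amounts to intersecting with the closed
    half-line that ends at rho m. *)
Lemma closed_kappa S : closed S -> closed (kappa S).
Proof.
move=> clS; have [[m [Sm ubm rm]]|nm] :=
  pselect (exists m, [/\ S m, ubound S m & rho S m < m]); last first.
  suff -> : kappa S = S by [].
  apply/seteqP; split; first exact: kappa_sub.
  by move=> t St; split => // -[ubt rt]; apply: nm; exists t.
suff -> : kappa S = S `&` [set t | t <= rho S m].
  by apply: closedI => //; exact: closed_le.
apply/seteqP; split => t [St]; last first.
  by move=> /= /le_lt_trans/(_ rm); exact: kappa_lt Sm.
move=> tNm; split => //=.
have tm : t < m.
  rewrite lt_neqAle ubm// andbT; apply/eqP => tm.
  by apply: tNm; rewrite tm.
rewrite /rho; case: asboolP => [_|]; last by case; exists t.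
by apply: ub_le_sup => //; exists m => s [_ /ltW].
Qed.

(** Replacing s by max a s keeps the set nonempty, so that the floor is a
    nondecreasing, hence measurable, function on the whole line. *)
Definition ts_floor S a s : R := sup [set u | S u /\ u <= Num.max a s].

Section Floor.
Variables (S : set R) (a : R).
Hypotheses (clS : closed S) (Sa : S a).

Let has_sup_floor s : has_sup [set u | S u /\ u <= Num.max a s].
Proof.
split; first by exists a; split => //; rewrite le_max lexx.
by exists (Num.max a s) => u [].
Qed.

Lemma ts_floor_mem s : S (ts_floor S a s).
Proof.
have [ne ub] := has_sup_floor s.
apply: (closure_subset_closed _ S clS _ _ (closure_sup ne ub)).
by move=> u [].
Qed.

Lemma ts_floor_le s : a <= s -> ts_floor S a s <= s.
Proof.
move=> as_; apply: ge_sup; first by case: (has_sup_floor s).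
by move=> u [_]; rewrite (max_idPr as_).
Qed.

Lemma le_ts_floor s u : S u -> u <= s -> u <= ts_floor S a s.
Proof.
move=> Su us; apply: ub_le_sup; first by case: (has_sup_floor s).
by split => //; rewrite le_max us orbT.
Qed.

Lemma ts_floor_homo : {homo ts_floor S a : s t / s <= t}.
Proof.
move=> s t st; apply: ge_sup; first by case: (has_sup_floor s).
move=> u [Su us]; apply: ub_le_sup; first by case: (has_sup_floor t).
by split => //; apply: le_trans us _; rewrite ge_max !le_max lexx st orbT.
Qed.

Lemma measurable_ts_floor : measurable_fun [set: measurableTypeR R] (ts_floor S a).
Proof. by apply: nondecreasing_measurable => //; exact: ts_floor_homo. Qed.

End Floor.

(** Between s and sigma t, in either order, the floor p of a point lies between
    s and t, because the time scale has no point strictly between t and sigma t.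
    Hence phi p is close to phi t there, and no distinction between dense and
    scattered points is required. The floor is described by its properties
    because the theorem uses the floor of S both on S and on kappa S. *)
Lemma is_delta_derive_integral S (X g phi : R -> R) L t :
  closed S -> has_ubound S -> S t ->
  measurable_fun [set: measurableTypeR R] g -> (forall s, `|g s| <= L) ->
  (forall u v, S u -> S v -> u <= v ->
    X v - X u = \int[lebesgue_measure]_(s in `[u, v[) g s) ->
  (forall u v s, S u -> S v -> u <= s < v -> exists p,
    [/\ S p, p <= s, forall q, S q -> q <= s -> q <= p & g s = phi p]) ->
  {for t, continuous phi} ->
  is_delta_derive S X t (phi t).
Proof.
move=> clS ubS St mg gL Xg gphi /cvgrPdist_le cphi e e0.
have [Sst tst sgm] := sigmaP _ _ clS ubS St.
have /nbhs_ballP[d /= d0 phid] := cphi e e0.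
suff: \forall s \near nbhs t, S s ->
    `|X (sigma S t) - X s - phi t * (sigma S t - s)| <= e * `|sigma S t - s|.
  by [].
near=> s => Ss.
have sd : `|t - s| < d by near: s; exact: nbhsx_ballx.
have near_t p : `|t - p| <= `|t - s| -> `|phi p - phi t| <= e.
  by move=> /le_lt_trans/(_ sd) /phid; rewrite /= distrC.
have [st|ts] := leP s t.
  have ssg : s <= sigma S t := le_trans st tst.
  rewrite Xg// (ger0_norm (_ : 0 <= sigma S t - s)) ?subr_ge0//.
  apply: Rintegral_itv_approx mg gL ssg _ => r /[dup] /andP[sr rsg].
  move=> /(gphi _ _ _ Ss Sst)[p [Sp pr maxp ->]]; apply: near_t.
  have sp : s <= p := maxp _ Ss sr.
  have pt : p <= t.
    by rewrite leNgt; apply/negP => /(sgm _ Sp); rewrite leNgt (le_lt_trans pr).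
  by rewrite !ger0_norm ?subr_ge0// lerD2l lerN2.
have sgs : sigma S t <= s := sgm _ Ss ts.
rewrite (_ : _ - _ = - (X s - X (sigma S t) - phi t * (s - sigma S t))); last by ring.
rewrite normrN Xg// (distrC (sigma S t)) (ger0_norm (_ : 0 <= s - sigma S t)) ?subr_ge0//.
apply: Rintegral_itv_approx mg gL sgs _ => r /[dup] /andP[sr rsg].
move=> /(gphi _ _ _ Sst Ss)[p [Sp pr maxp ->]]; apply: near_t.
have tp : t <= p := le_trans tst (maxp _ Sst sr).
rewrite !(distrC t) !ger0_norm ?subr_ge0 ?lerD2r//; last exact: ltW.
exact: le_trans pr (ltW rsg).
Unshelve. all: by end_near.
Qed.

End TimeScaleFacts.

(** * Divergence of the crossing times *)

Section OsgoodCondition.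
Context {R : realType}.
Implicit Types (h w wt : R -> R) (l r x B C M : R).

(** Comparison of the integral of a nonincreasing function with its left
    Riemann sum of step 1. *)
Lemma oriented_integral_sum_unbounded h l r :
  (forall x, 1 <= x -> 0 <= h x) ->
  (forall x y, 1 <= x -> x <= y -> h y <= h x) ->
  oriented_integral h 1 x @[x --> +oo] --> +oo ->
  1 < r -> exists N : nat, l <= \sum_(k < N) h (r + k%:R).
Proof.
move=> h0 hni Goo r1.
(* A function that is monotone, hence measurable, and bounded on the whole line. *)
pose hb s := h (Num.max 1 s).
have max1 s : (1 : R) <= Num.max 1 s by rewrite le_max lexx.
have mhb : measurable_fun [set: measurableTypeR R] hb.
  rewrite (_ : hb = -%R \o (fun s => - hb s)); last first.
    by apply/funext => s /=; rewrite opprK.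
  apply: measurableT_comp => //; apply: nondecreasing_measurable => // s t st.
  by rewrite lerN2 hni// ge_max !le_max lexx st orbT.
have hb_bd s : `|hb s| <= h 1 by rewrite ger0_norm ?h0// hni.
pose I := running_integral 1 hb.
have GE x : 1 < x -> oriented_integral h 1 x = I x.
  move=> x1; rewrite /oriented_integral [X in _ - X](_ : _ = 0) ?subr0; last first.
    by rewrite set_itv_ge ?Rintegral_set0// bnd_simp -ltNge.
  rewrite /I /running_integral Rintegral_itv_bndo_bndc; last first.
    exact: bounded_integrable_itv mhb hb_bd.
  apply: eq_Rintegral => s; rewrite inE/= in_itv/= => /andP[s1 _].
  by rewrite /hb (max_idPr s1).
have step x : 1 <= x -> I (x + 1) <= I x + h x.
  move=> x1; have xx1 : x <= x + 1 by rewrite lerDl.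
  rewrite -lerBlDl (running_integralB 1 hb (h 1))//.
  have := @Rintegral_itv_approx R hb (h 1) 0 (h x) x (x + 1) mhb hb_bd xx1.
  rewrite mul0r subr0 addrAC subrr add0r mulr1 => /(_ _)/(le_trans (ler_norm _)).
  apply=> s /andP[xs _]; rewrite subr0 ger0_norm ?h0// hni// (max_idPr _)//.
  exact: le_trans xs.
have sumI N : I (r + N%:R) <= I r + \sum_(k < N) h (r + k%:R).
  elim: N => [|N ih]; first by rewrite big_ord0 !addr0.
  rewrite big_ord_recr/= addrA -natr1 addrA.
  apply: le_trans (step _ _) _; last by rewrite lerD2r.
  by rewrite (le_trans (ltW r1))// lerDl.
have /cvgryPge/(_ (l + I r))[x0 [_ Gx0]] := Goo.
pose N := Num.bound `|x0|; exists N.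
have x0N : x0 < r + N%:R.
  apply: lt_trans (le_lt_trans (ler_norm x0) (archi_boundP (normr_ge0 x0))) _.
  by rewrite ltrDr (lt_trans ltr01).
have rN1 : 1 < r + N%:R by rewrite (lt_le_trans r1)// lerDl.
have := Gx0 _ x0N; rewrite GE// => /le_trans/(_ (sumI N)).
by rewrite addrC lerD2l.
Qed.

Lemma growth_time_unbounded w wt M B C l r :
  nonneg_nondecreasing_C w -> nonneg_nondecreasing_C wt ->
  0 <= M -> 0 < B -> 0 < C -> 1 < r ->
  oriented_integral (fun s => 1 / w (Num.max s (M * wt s))) 1 x
    @[x --> +oo] --> +oo ->
  exists N : nat, l <=
    \sum_(k < N) (B * w (Num.max (r + k%:R) (M * wt (r + k%:R))) + C)^-1.
Proof.
move=> [_ w0 wnd wpos] [_ wt0 wtnd _] M0 B0 C0 r1 Goo.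
pose W x := w (Num.max x (M * wt x)).
have Wpos x : 1 <= x -> 0 < W x.
  by move=> x1; apply: wpos; rewrite lt_max (lt_le_trans ltr01 x1).
have Wnd x y : 1 <= x -> x <= y -> W x <= W y.
  move=> x1 xy; have x0 : 0 <= x := le_trans ler01 x1.
  apply: wnd; first by rewrite le_max x0.
  rewrite ge_max !le_max xy/= ler_wpM2l ?orbT//; exact: wtnd.
(* Since W >= W 1 on [1, +oo[, adding C only costs a constant factor:
   B * W + C <= c * W. *)
pose c := B + C / W 1.
have c0 : 0 < c by rewrite addr_gt0// divr_gt0// Wpos.
have [] := @oriented_integral_sum_unbounded (fun s => 1 / W s) (c * l) r _ _ Goo r1.
- by move=> x /Wpos/ltW Wx; rewrite divr_ge0.
- move=> x y x1 xy; rewrite !div1r lef_pV2 ?posrE ?Wpos//; last exact: le_trans xy.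
  exact: Wnd.
move=> N lN; exists N; rewrite -(ler_pM2l c0); apply: le_trans lN _.
rewrite mulr_sumr; apply: ler_sum => k _; set x := r + k%:R.
have x1 : 1 <= x by rewrite (le_trans (ltW r1))// lerDl.
have Wx := Wpos _ x1.
rewrite -/(W x) ler_pdivrMr// mulrAC ler_pdivlMr ?mul1r; last first.
  by rewrite addr_gt0// mulr_gt0.
by rewrite /c mulrDl lerD2l mulrAC ler_pdivlMr ?Wpos// ler_pM2l// Wnd.
Qed.

End OsgoodCondition.

(** * Lipschitz functions *)

Lemma lipschitz_continuous {R : realType} (f : R -> R) (L : R) :
  (forall s t, `|f t - f s| <= L * `|t - s|) -> continuous f.
Proof.
move=> fL t; apply/cvgrPdist_le => e e0.
have L0 : 0 <= L.
  by have := fL 0 1; rewrite subr0 normr1 mulr1; apply: le_trans.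
have L1 : 0 < L + 1 by rewrite ltr_wpDl.
pose d := e / (L + 1); have d0 : 0 < d by rewrite divr_gt0.
near=> s; apply: le_trans (fL _ _) _.
have : `|t - s| < d by near: s; apply/nbhs_ballP; exists d.
rewrite ltr_pdivlMr// mulrC => /ltW; apply: le_trans.
by rewrite ler_wpM2r// lerDl.
Unshelve. all: by end_near.
Qed.

Section EquiLipschitz.
Context {R : realType}.
Implicit Types (L b e s t : R).

Lemma fmap_ultra T T' (f : T -> T') (U : set_system T) :
  UltraFilter U -> UltraFilter (f @ U).
Proof.
move=> UU; split => [|G GF sUG]; first exact: fmap_proper_filter.
apply/seteqP; split => // A GA.
have [//|UnA] := in_ultra_setVsetC (f @^-1` A) UU.
have GnA : G (~` A) by exact: sUG.
by have [z []] := filter_ex (filterI GA GnA).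
Qed.

(** A limit along an ultrafilter exists at every point at once. The k-th term
    of the subsequence is then chosen close to this limit at the first k
    rational points, and the common Lipschitz constant carries the convergence
    over to all real points. *)
Lemma equi_lipschitz_subsequence (y : nat -> R -> R) L b :
  (forall n s t, `|y n t - y n s| <= L * `|t - s|) ->
  (forall n t, `|y n t| <= b) ->
  exists (f : nat -> nat) (x : R -> R),
    (forall k, (k <= f k)%N) /\
    forall t, y (f k) t @[k --> \oo] --> x t.
Proof.
move=> yL yb; have L0 : 0 <= L.
  by have := yL 0%N 0 1; rewrite subr0 normr1 mulr1; apply: le_trans.
have [U [UU ooU]] := ultraFilterLemma (@eventually_filter).
have UP : ProperFilter U := @ultra_proper _ _ UU.
have lim_ex : forall t : R, exists l : R, y n t @[n --> U] --> l.
  move=> t; have := @segment_compact R (- b) b; rewrite compact_ultra.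
  move=> /(_ (y n t @[n --> U])); case.
  - exact: fmap_ultra.
  - by apply: (@filterE _ U) => n; rewrite /= in_itv/= -ler_norml; exact: yb.
  - by move=> l [_ yl]; exists l.
have [x yx] := choice lim_ex.
have xL s t : `|x t - x s| <= L * `|t - s|.
  apply: (closed_cvg (fun r => r <= L * `|t - s|) (@closed_le _ _) _ _
    (cvg_norm (cvgB (yx t) (yx s)))).
  by apply: nearW => n; exact: yL.
pose q i : R := ratr (odflt 0 (unpickle i)).
have f_ex k : exists n, (k <= n)%N /\
    forall i : 'I_k, `|x (q i) - y n (q i)| <= k.+1%:R^-1.
  apply: (@filter_ex _ U); apply: filterI.
    by apply: ooU; exact: nbhs_infty_ge.
  apply: filter_forall => i; have /cvgrPdist_le := yx (q i); apply.
  by rewrite invr_gt0.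
have [f fP] := choice f_ex.
exists f, x; split => [k|t]; first by case: (fP k).
apply/cvgrPdist_le => e e0; pose d := e / 3.
have d0 : 0 < d by rewrite divr_gt0.
(* L may vanish, whence L + 1. *)
pose d' := d / (L + 1); have L10 : 0 < L + 1 by rewrite ltr_wpDl.
have d'0 : 0 < d' by rewrite divr_gt0.
have [r rt] : exists r : rat, `|t - ratr r| <= d'.
  have [|r] := @rat_in_itvoo R (t - d') (t + d'); first by lra.
  rewrite in_itv/= => /andP[tr rt]; exists r.
  by rewrite ler_distl; apply/andP; split; lra.
have Ld : L * `|t - ratr r| <= d.
  apply: le_trans (ler_wpM2l L0 rt) _.
  by rewrite /d' mulrA ler_pdivrMr// mulrC ler_pM2l// lerDl.
near=> k.
have kr : (pickle r < k)%N by near: k; exact: nbhs_infty_gt.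
have [_ /(_ (Ordinal kr))] := fP k; rewrite /q/= pickleK/= => yxr.
have kd : k.+1%:R^-1 <= d.
  near: k; have /cvgrPdist_le/(_ d d0) := @cvg_harmonic R.
  apply: filterS => k; rewrite sub0r normrN ger0_norm// invr_ge0.
  exact: ler0n.
rewrite (_ : x t - _ = (x t - x (ratr r)) + (x (ratr r) - y (f k) (ratr r))
  + (y (f k) (ratr r) - y (f k) t)); last by ring.
rewrite (_ : e = d + d + d); last by rewrite /d; field.
apply: le_trans (ler_normD _ _) (lerD _ _).
  apply: le_trans (ler_normD _ _) (lerD _ _); last exact: le_trans yxr kd.
  exact: le_trans (xL _ _) Ld.
by rewrite (le_trans (yL _ _ _))// distrC.
Unshelve. all: by end_near.
Qed.

End EquiLipschitz.

(** * The delayed equation and its limit *)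

Lemma continuous_cvg3 {R : realType} {T : Type} (F : set_system T) {FF : Filter F}
    (H : R * R * R -> R) (f g h : T -> R) (l m n : R) :
  continuous H ->
  f x @[x --> F] --> l -> g x @[x --> F] --> m -> h x @[x --> F] --> n ->
  H (f x, g x, h x) @[x --> F] --> H (l, m, n).
Proof.
move=> cH fl gm hn; have fgh : (f x, g x, h x) @[x --> F] --> ((l, m, n) : R * R * R).
  exact: (cvg_pair (cvg_pair fl gm) hn).
exact: (cvg_comp _ _ fgh (cH (l, m, n))).
Qed.

Section Tonelli.
Context {R : realType}.
Variables (F K : R * R * R -> R) (LF LK : R) (fl : R -> R) (a b A : R).
Hypotheses (cF : continuous F) (cK : continuous K).
Hypotheses (FL : forall p, `|F p| <= LF) (KL : forall p, `|K p| <= LK).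
Hypothesis mfl : measurable_fun [set: measurableTypeR R] fl.
Hypothesis fl_le : forall s, a <= s -> fl s <= s.
Implicit Types (x y : R -> R) (c h s t u : R).

Definition memory x t : R :=
  running_integral a (fun tau => K (t, fl tau, x (fl tau))) t.

Definition memory_rhs x t : R := F (t, x t, memory x t).

(** The delayed integral operator; for h = 0 its fixed points are the solutions
    of the equation. The cut at b makes its values constant after b, so that
    fixed points and bounds need to be controlled up to b only. *)
Definition tonelli h x t : R :=
  A + running_integral a (fun s => memory_rhs x (fl s)) (Num.min t b - h).

Lemma measurable_comp_floor (phi : R -> R) : continuous phi ->
  measurable_fun [set: measurableTypeR R] (fun s => phi (fl s)).
Proof.
move=> cphi; apply: (measurableT_comp _ mfl).
exact: continuous_measurable_fun.
Qed.

Lemma measurable_kernel x t : continuous x ->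
  measurable_fun [set: measurableTypeR R] (fun s => K (t, fl s, x (fl s))).
Proof.
move=> cx; apply: (@measurable_comp_floor (fun u => K (t, u, x u))) => u.
by apply: continuous_cvg3 => //; [exact: cvg_cst|exact: cx].
Qed.

(** Convergence in x and t jointly: a fixed x gives the continuity in time, a
    fixed t the passage to the limit along approximate solutions. *)
Lemma memory_cvg (y : nat -> R -> R) x (tn : nat -> R) t :
  (forall n, continuous (y n)) -> continuous x ->
  (forall s, y n s @[n --> \oo] --> x s) -> tn n @[n --> \oo] --> t ->
  memory (y n) (tn n) @[n --> \oo] --> memory x t.
Proof.
move=> cy cx yx tnt; apply: (running_integral_cvg a
  (fun n s => K (tn n, fl s, y n (fl s))) (fun s => K (t, fl s, x (fl s))) LK) => //.
- by move=> n; exact: measurable_kernel.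
- exact: measurable_kernel.
- by move=> s; apply: continuous_cvg3 => //; exact: cvg_cst.
Qed.

Lemma continuous_memory_rhs x : continuous x -> continuous (memory_rhs x).
Proof.
move=> cx t; have mt : memory x u @[u --> t] --> memory x t.
  apply/(@cvg_nbhsP _ R^o) => u ut.
  by apply: (@memory_cvg (fun=> x)) => // s; exact: cvg_cst.
exact: (continuous_cvg3 _ _ _ _ _ _ _ _ cF (@cvg_id _ (nbhs t)) (cx t) mt).
Qed.

Lemma measurable_memory_rhs x : continuous x ->
  measurable_fun [set: measurableTypeR R] (fun s => memory_rhs x (fl s)).
Proof. by move=> cx; apply: measurable_comp_floor; exact: continuous_memory_rhs. Qed.

Lemma tonelli_lipschitz h x s t : continuous x ->
  `|tonelli h x t - tonelli h x s| <= LF * `|t - s|.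
Proof.
move=> cx; rewrite /tonelli opprD addrACA subrr add0r.
have LF0 : 0 <= LF := le_trans (normr_ge0 _) (FL (0, 0, 0)).
apply: le_trans (running_integral_lipschitz _ _ LF _ _ _ _) _ => //.
  exact: measurable_memory_rhs.
  by move=> u; exact: FL.
apply: (ler_wpM2l LF0); rewrite !opprD addrACA subrr addr0.
wlog st : s t / s <= t => [hw|].
  have [/hw//|/ltW/hw] := leP s t.
  by rewrite distrC (distrC s).
rewrite !ger0_norm ?subr_ge0//; last first.
  by rewrite le_min !ge_min st lexx orbT.
by rewrite /Num.min; case: ltP => tb; case: ltP => sb; lra.
Qed.

Lemma continuous_tonelli h x : continuous x -> continuous (tonelli h x).
Proof.
move=> cx; apply: (@lipschitz_continuous _ _ LF) => s t.
exact: tonelli_lipschitz.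
Qed.

(** Causality: the floor moves points to the left, so tonelli h x at time t only
    depends on x before t - h. *)
Lemma eq_tonelli h x y c t :
  (forall s, s <= c -> x s = y s) -> Num.min t b - h <= c ->
  tonelli h x t = tonelli h y t.
Proof.
move=> xy tc; congr (A + _); apply: eq_Rintegral => s.
rewrite inE/= in_itv/= => /andP[as_ st].
have fc : fl s <= c by rewrite (le_trans (fl_le _ as_))// (le_trans (ltW st)).
rewrite /memory_rhs xy// /memory; congr (F (_, _, _)).
apply: eq_Rintegral => u; rewrite inE/= in_itv/= => /andP[au us].
by rewrite xy// (le_trans (fl_le _ au))// (le_trans (ltW us)).
Qed.

(** By causality the k-th and the next iterate agree up to time a + k h, so the
    iteration becomes stationary. Q is any invariant to keep along the way. *)
Lemma tonelli_fixpoint h (Q : (R -> R) -> Prop) : 0 < h ->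
  Q (cst A) -> (forall x, Q x -> Q (tonelli h x)) ->
  exists2 x, tonelli h x = x & Q x.
Proof.
move=> h0 QA Qt; pose y k := iter k (tonelli h) (cst A).
have yE k t : t <= a + h *+ k -> y k.+1 t = y k t.
  elim: k t => [|k ih] t.
    rewrite addr0 /y/= /tonelli => ta; rewrite running_integral_eq0 ?addr0//.
    by rewrite (@le_trans _ _ t)// lerBlDr ge_min lerDl ltW.
  rewrite mulrSr addrA -lerBlDr => ta; apply: (@eq_tonelli _ _ _ (a + h *+ k)).
    exact: ih.
  by apply: le_trans ta; rewrite lerD2r ge_min lexx.
have [N bN] : exists N : nat, b <= a + h *+ N.
  exists (Num.bound `|(b - a) / h|).
  rewrite -lerBlDl -mulr_natl -ler_pdivrMr//.
  exact: le_trans (ler_norm _) (ltW (archi_boundP (normr_ge0 _))).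
(* y N and y N.+1 agree up to b, which determines the next iterate everywhere. *)
exists (y N.+1); last by elim: N.+1 => [//|n ih]; exact: Qt.
apply/funext => t; apply: (@eq_tonelli _ _ _ b).
  by move=> s sb; apply: yE; exact: le_trans sb bN.
by rewrite lerBlDr ge_min lerDl (ltW h0) orbT.
Qed.

(** The Lipschitz constant LF and the bound r are the same for all h, which
    provides the compactness needed to let h tend to 0. *)
Lemma tonelli_solution r (Q : (R -> R) -> Prop) :
  Q (cst A) ->
  (forall h x, 0 < h -> continuous x -> Q x -> Q (tonelli h x)) ->
  (forall x t, Q x -> `|x t| <= r) ->
  exists x, [/\ continuous x, tonelli 0 x = x & forall t, `|x t| <= r].
Proof.
move=> QA Qt Qr.
have ex_y n : exists y, tonelli n.+1%:R^-1 y = y /\ continuous y /\ Q y.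
  have n0 : 0 < n.+1%:R^-1 :> R by rewrite invr_gt0.
  have [||y yE cQy] := @tonelli_fixpoint n.+1%:R^-1
      (fun y => continuous y /\ Q y) n0.
  - by split => // t; exact: cvg_cst.
  - by move=> y [cy Qy]; split; [exact: continuous_tonelli|exact: Qt].
  - by exists y.
have [y yP] := choice ex_y.
have yL n s t : `|y n t - y n s| <= LF * `|t - s|.
  have [yE [cy _]] := yP n; rewrite -yE; exact: tonelli_lipschitz.
have [f [x [fk yx]]] := @equi_lipschitz_subsequence R y LF r yL
  (fun n t => Qr _ t (yP n).2.2).
have foo : f k @[k --> \oo] --> \oo.
  apply/cvgnyPge => m; near=> k; apply: leq_trans (fk k).
  by near: k; exact: nbhs_infty_ge.
have cy n : continuous (y n) := (yP n).2.1.
have xL s t : `|x t - x s| <= LF * `|t - s|.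
  apply: (closed_cvg (fun r => r <= LF * `|t - s|) (@closed_le _ _) _ _
    (cvg_norm (cvgB (yx t) (yx s)))).
  by apply: nearW => n; exact: yL.
have cx : continuous x := lipschitz_continuous _ _ xL.
exists x; split => //.
  apply/funext => t.
  suff xt : y (f k) t @[k --> \oo] --> tonelli 0 x t.
    by rewrite -(cvg_lim (@Rhausdorff R) xt); apply: (cvg_lim (@Rhausdorff R) (yx t)).
  rewrite (_ : (fun k => y (f k) t) =
      (fun k => tonelli (f k).+1%:R^-1 (y (f k)) t)); last first.
    by apply/funext => k; rewrite (yP (f k)).1.
  rewrite /tonelli; apply: cvgD; first exact: cvg_cst.
  apply: (running_integral_cvg a (fun k s => memory_rhs (y (f k)) (fl s))
    (fun s => memory_rhs x (fl s)) LF
    (fun k => Num.min t b - (f k).+1%:R^-1)) => //.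
  - by move=> k; exact: measurable_memory_rhs.
  - by move=> k s; exact: FL.
  - exact: measurable_memory_rhs.
  - move=> s; apply: continuous_cvg3 => //; first exact: cvg_cst.
    by apply: (@memory_cvg (fun k => y (f k))) => //; exact: cvg_cst.
  - apply: cvgB; first exact: cvg_cst.
    exact: (cvg_comp _ _ foo (@cvg_harmonic R)).
move=> t; apply: (closed_cvg (fun s => s <= r) (@closed_le _ _) _ _
  (cvg_norm (yx t))).
by apply: nearW => k; apply: Qr; case: (yP (f k)) => _ [].
Unshelve. all: by end_near.
Qed.

(** The levels r0 + k are paired with times T k such that level r0 + k cannot be
    passed before T k: on [T k, T k.+1[ the speed is at most H k, and
    T k.+1 - T k = 1 / H k is the time needed to climb by 1 at that speed. The
    bound on the speed at level k.+1 presupposes the bound on x up to T k.+1,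
    which is harmless since it is applied to the argument of the operator and
    yields the bound for its value. *)
Lemma tonelli_level_solution (H : nat -> R) (r0 : R) (N : nat) :
  (forall k, 0 < H k) -> `|A| <= r0 ->
  b - a <= \sum_(k < N) (H k)^-1 ->
  (forall x k s, (k < N)%N -> continuous x ->
    (forall u, u <= s -> `|x u| <= r0 + k.+1%:R) -> a <= s < b ->
    `|memory_rhs x (fl s)| <= H k) ->
  exists x, [/\ continuous x, tonelli 0 x = x & forall t, `|x t| <= r0 + N%:R].
Proof.
move=> H0 Ar bN rhsH; pose T k := a + \sum_(i < k) (H i)^-1.
have TS k : T k.+1 = T k + (H k)^-1 by rewrite /T big_ord_recr/= addrA.
have aT k : a <= T k.
  by rewrite lerDl sumr_ge0// => i _; rewrite invr_ge0 ltW.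
have bT : b <= T N by rewrite /T -lerBlDl.
pose Q x := (forall k t, (k <= N)%N -> t <= T k -> `|x t| <= r0 + k%:R) /\
  (forall t, `|x t| <= r0 + N%:R).
have [||_ t [_ ->]//|x xP] := @tonelli_solution (r0 + N%:R) Q; last by exists x.
  by split => [k t _ _|t]; rewrite (le_trans Ar)// lerDl.
move=> h x h0 cx [xT _].
pose I := running_integral a (fun s => memory_rhs x (fl s)).
have mg := measurable_memory_rhs _ cx.
have gL s : `|memory_rhs x (fl s)| <= LF by exact: FL.
have IT k t : (k <= N)%N -> t <= T k -> t <= b -> `|A + I t| <= r0 + k%:R.
  elim: k t => [|k ih] t kN.
    rewrite /T big_ord0 !addr0 => ta _.
    by rewrite /I running_integral_eq0// addr0.
  move=> tT tb; have [tTk|Tkt] := leP t (T k).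
    by apply: le_trans (ih _ (ltnW kN) tTk tb) _; rewrite lerD2l ler_nat.
  have Tkb : T k <= b := le_trans (ltW Tkt) tb.
  have := ih _ (ltnW kN) (lexx _) Tkb.
  have : `|I t - I (T k)| <= 1.
    rewrite /I (running_integralB _ _ LF)// ?(ltW Tkt)//.
    apply: (@le_trans _ _ (H k * (t - T k))); last first.
      by rewrite mulrC -ler_pdivlMr// div1r lerBlDl -TS.
    have := @Rintegral_itv_approx R _ LF 0 (H k) (T k) t mg gL (ltW Tkt).
    rewrite mul0r subr0; apply => s /andP[Tks st]; rewrite subr0.
    apply: rhsH => //; last by rewrite (le_trans (aT k))// (lt_le_trans st).
    by move=> u us; apply: xT => //; rewrite (le_trans us)// (le_trans (ltW st)).
  rewrite -natr1 addrA => h1 h2.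
  rewrite (_ : A + I t = (A + I (T k)) + (I t - I (T k))); last by ring.
  by apply: le_trans (ler_normD _ _) _; exact: lerD.
have minb t : Num.min t b - h <= b by rewrite lerBlDr ge_min lerDl (ltW h0) orbT.
split => [k t kN tT|t]; apply: IT => //; last exact: le_trans bT.
by rewrite lerBlDr ge_min (le_trans tT)// lerDl ltW.
Qed.

End Tonelli.

(** * Truncation and extension of the data *)

Section Truncation.
Context {R : realType}.
Implicit Types (c m t x : R).

Definition clamp c x : R := Num.max (- c) (Num.min c x).

Lemma clamp_id c x : `|x| <= c -> clamp c x = x.
Proof.
by rewrite ler_norml => /andP[cx xc]; rewrite /clamp (min_idPr xc) (max_idPr cx).
Qed.

Lemma clamp_norm c x : 0 <= c -> `|clamp c x| <= c.
Proof.
move=> c0; rewrite ler_norml /clamp le_max lexx/= ge_max ge_min lexx/= andbT.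
by rewrite (le_trans _ c0)// oppr_le0.
Qed.

Lemma continuous_clamp c : continuous (clamp c).
Proof.
apply: (@lipschitz_continuous R _ 1) => s t; rewrite mul1r.
wlog st : s t / s <= t => [hw|].
  by have [/hw//|/ltW/hw] := leP s t; rewrite distrC (distrC s).
have [] : Num.min c s <= Num.min c t /\ Num.min c t <= Num.min c s + (t - s).
  by rewrite /Num.min; do 2 case: ltP => ?; split; lra.
rewrite /clamp; move: (Num.min c s) (Num.min c t) => u v uv vu.
rewrite ger0_norm ?(ger0_norm (_ : 0 <= t - s)) ?subr_ge0//; rewrite /Num.max.
  by do 2 case: ltP => ?; lra.
by do 2 case: ltP => ?; lra.
Qed.

(** Composing with pi, which is meant to clamp the arguments that range over an
    unbounded set, makes H bounded, so that the Tietze theorem applies; nothing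
    is changed at the fixed points of pi. *)
Lemma bounded_extension (E : set (R * R * R)) (pi : R * R * R -> R * R * R)
    (H : R * R * R -> R) m :
  closed E -> continuous pi -> (forall p, E p -> E (pi p)) ->
  {within E, continuous H} -> 0 < m -> (forall p, E p -> `|H (pi p)| <= m) ->
  exists H' : R * R * R -> R, [/\ continuous H', forall p, `|H' p| <= m &
    forall p, E p -> pi p = p -> H' p = H p].
Proof.
move=> clE cpi Epi cH m0 Hm.
have cHpi : {within E, continuous (H \o pi)}.
  apply/subspace_continuousP => p Ep.
  have /subspace_continuousP/(_ _ (Epi _ Ep)) cHp := cH.
  have pip : pi q @[q --> within E (nbhs p)] `=>` within E (nbhs (pi p)).
    move=> B nB.
    have nB' : \forall q \near p, E (pi q) -> B (pi q) := cpi p _ nB.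
    suff: \forall q \near p, E q -> B (pi q) by [].
    by apply: filterS nB' => q EB Eq; apply: EB; exact: Epi.
  exact: (cvg_comp pi H pip cHp).
have [g [gE cg gm]] := continuous_bounded_extension
  (@pseudometric_normal R (R * R * R)%type) clE m0 cHpi Hm.
exists g; split => // p Ep pip.
by rewrite -(gE p) ?inE//= pip.
Qed.

Lemma closed_setX3 (E1 E2 : set R) : closed E1 -> closed E2 ->
  closed (E1 `*` E2 `*` [set: R]).
Proof.
move=> cl1 cl2.
rewrite (_ : _ `*` _ = (fun p : R * R * R => p.1.1) @^-1` E1 `&`
    (fun p : R * R * R => p.1.2) @^-1` E2); last first.
  by apply/seteqP; split => p /= [] // [].
by apply: closedI; apply: preimage_closed => // p _;
  apply: continuous_comp; [exact: cvg_fst|exact: cvg_fst|exact: cvg_fst|exact: cvg_snd].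
Qed.

Lemma continuous_clamp_last c :
  continuous (fun p : R * R * R => (p.1, clamp c p.2)).
Proof.
move=> [p1 p2].
have c2 : q.2 @[q --> ((p1, p2) : R * R * R)] --> p2 by exact: cvg_snd.
have c1 : q.1 @[q --> ((p1, p2) : R * R * R)] --> p1 by exact: cvg_fst.
exact: (cvg_pair c1 (cvg_comp _ _ c2 (continuous_clamp c p2))).
Qed.

Lemma continuous_clamp_last2 c :
  continuous (fun p : R * R * R => (p.1.1, clamp c p.1.2, clamp c p.2)).
Proof.
move=> [[p1 p2] p3].
have c3 : q.2 @[q --> ((p1, p2, p3) : R * R * R)] --> p3 by exact: cvg_snd.
have c12 : q.1 @[q --> ((p1, p2, p3) : R * R * R)] --> (p1, p2).
  exact: cvg_fst.
have c1 : q.1.1 @[q --> ((p1, p2, p3) : R * R * R)] --> p1.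
  by apply: (cvg_comp _ _ c12); exact: cvg_fst.
have c2 : q.1.2 @[q --> ((p1, p2, p3) : R * R * R)] --> p2.
  by apply: (cvg_comp _ _ c12); exact: cvg_snd.
exact: (cvg_pair (cvg_pair c1 (cvg_comp _ _ c2 (continuous_clamp c p2)))
  (cvg_comp _ _ c3 (continuous_clamp c p3))).
Qed.

End Truncation.

(** * Existence of a solution *)

Theorem theorem105 (R : realType) (T : set R) (a b A : R)
    (K F : R * R * R -> R) (B C D : R) (w wt : R -> R) :
  time_scale T -> T a -> T b -> a < b ->
  {within kappa (ts_itv T a b) `*` kappa (kappa (ts_itv T a b)) `*` setT,
    continuous K} ->
  {within kappa (ts_itv T a b) `*` setT `*` setT, continuous F} ->
  0 < B -> 0 < C -> 0 < D ->
  (forall t x y : R, kappa (ts_itv T a b) t ->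
    `|F (t, x, y)| <= B * w (Num.max `|x| `|y|) + C) ->
  (forall t s x : R,
    kappa (ts_itv T a b) t -> kappa (kappa (ts_itv T a b)) s ->
    `|K (t, s, x)| <= D * wt `|x|) ->
  nonneg_nondecreasing_C w ->
  nonneg_nondecreasing_C wt ->
  (let M := (b - a) * D in
   let G := oriented_integral (fun s => 1 / w (Num.max s (M * wt s))) 1 in
   G x @[x --> +oo] --> +oo) ->
  exists x : R -> R,
    [/\ delta_C1 (ts_itv T a b) x,
        x a = A &
        forall t, kappa (ts_itv T a b) t ->
          exists2 v : R,
            is_delta_integral (kappa (ts_itv T a b))
              (fun tau => K (t, tau, x tau)) a t v &
            is_delta_derive (ts_itv T a b) x t (F (t, x t, v))].
Proof.
move=> [_ clT] Ta Tb ab cK cF B0 C0 D0 Fbd Kbd wC wtC Goo.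
pose M := (b - a) * D.
have {}Goo : oriented_integral (fun s => 1 / w (Num.max s (M * wt s))) 1 x
    @[x --> +oo] --> +oo by exact: Goo.
set S := ts_itv T a b; set S1 := kappa S; set S2 := kappa S1.
have clS : closed S by apply: closedI => //; exact: itv_closed.
have Sa : S a by split => //=; rewrite in_itv/= lexx ltW.
have Sb : S b by split => //=; rewrite in_itv/= lexx ltW.
have Sab s : S s -> a <= s <= b by case; rewrite /= in_itv.
have ubS : has_ubound S by exists b => s /Sab/andP[].
have S1S : S1 `<=` S := kappa_sub S.
have clS1 : closed S1 := closed_kappa S clS.
have ubS1 : has_ubound S1 by exists b => s /S1S/Sab/andP[].
have [_ _ wnd _] := wC; have [_ wt0 wtnd _] := wtC.
have M0 : 0 <= M by rewrite mulr_ge0 ?ltW// subr_gt0.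
pose fl := ts_floor S a.
have mfl : measurable_fun [set: measurableTypeR R] fl by exact: measurable_ts_floor.
have fl_le s : a <= s -> fl s <= s by exact: ts_floor_le.
have flS s : S (fl s) by exact: ts_floor_mem.
have flS1 v s : S v -> a <= s < v -> S1 (fl s).
  move=> Sv /andP[as_ sv]; apply: (kappa_lt _ _ v) => //.
  exact: le_lt_trans (fl_le _ as_) sv.
(* K is only given on kappa (kappa S); the floor of a point before v in kappa S
   falls there. *)
have flS2 v s : S1 v -> a <= s < v -> S2 (fl s).
  move=> S1v asv; have /andP[as_ sv] := asv; apply: (kappa_lt _ _ v) => //.
    by apply: flS1 asv; exact: S1S.
  exact: le_lt_trans (fl_le _ as_) sv.
(* The sum over levels needs a starting level r0 + 1 greater than 1, as G is
   based at 1. *)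
pose r0 := 1 + `|A|.
pose H (k : nat) := B * w (Num.max (r0 + k.+1%:R) (M * wt (r0 + k.+1%:R))) + C.
have rk k : 0 <= r0 + k%:R by rewrite !addr_ge0.
have H0 k : 0 < H k.
  by rewrite ltr_wpDl// mulr_ge0 ?(ltW B0)//; case: wC => _ + _ _; apply;
    rewrite le_max rk.
have [N bN] : exists N : nat, b - a <= \sum_(k < N) (H k)^-1.
  have [|N] := @growth_time_unbounded _ w wt M B C (b - a) (r0 + 1) wC wtC M0 B0 C0 _ Goo.
    by rewrite ltrDr ltr_wpDr.
  move=> bN; exists N; apply: le_trans bN _; apply: ler_sum => k _.
  by rewrite /H -addrA (addrC 1) natr1.
(* r bounds the solution and l bounds both arguments of F. *)
pose r := r0 + N%:R; have r_ge0 : 0 <= r by exact: rk.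
pose l := Num.max r (M * wt r); have rl : r <= l by rewrite le_max lexx.
have l0 : 0 <= l := le_trans r_ge0 rl.
have [K' [cK' K'L K'E]] : exists K' : R * R * R -> R,
    [/\ continuous K', forall p, `|K' p| <= D * wt r + 1 &
    forall p, (S1 `*` S2 `*` setT) p -> (p.1, clamp r p.2) = p -> K' p = K p].
  apply: (@bounded_extension R _ (fun p => (p.1, clamp r p.2))).
  - by apply: closed_setX3 => //; exact: closed_kappa.
  - exact: continuous_clamp_last.
  - by move=> p [].
  - exact: cK.
  - by rewrite ltr_wpDl// mulr_ge0 ?wt0// ltW.
  - move=> [[t s] x] [[/= St Ss] _]; apply: le_trans (Kbd _ _ _ St Ss) _.
    by rewrite ler_wpDr// ler_wpM2l ?(ltW D0)// wtnd// clamp_norm.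
have [F' [cF' F'L F'E]] : exists F' : R * R * R -> R,
    [/\ continuous F', forall p, `|F' p| <= B * w l + C &
    forall p, (S1 `*` setT `*` setT) p ->
      (p.1.1, clamp l p.1.2, clamp l p.2) = p -> F' p = F p].
  apply: (@bounded_extension R _ (fun p => (p.1.1, clamp l p.1.2, clamp l p.2))).
  - by apply: closed_setX3 => //; exact: closedT.
  - exact: continuous_clamp_last2.
  - by move=> p [[]].
  - exact: cF.
  - by rewrite ltr_wpDl// mulr_ge0 ?(ltW B0)//; case: wC => _ + _ _; apply.
  - move=> [[t x] y] [[/= St _] _]; apply: le_trans (Fbd _ _ _ St) _.
    rewrite lerD2r ler_wpM2l ?(ltW B0)//; apply: wnd.
      by rewrite le_max normr_ge0.
    by rewrite /= ge_max !clamp_norm.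
have {}K'E t s x : S1 t -> S2 s -> `|x| <= r -> K' (t, s, x) = K (t, s, x).
  by move=> St Ss xr; apply: K'E => //=; rewrite clamp_id.
have {}F'E t x y : S1 t -> `|x| <= l -> `|y| <= l -> F' (t, x, y) = F (t, x, y).
  by move=> St xl yl; apply: F'E => //=; rewrite !clamp_id.
pose mem := memory K' fl a; pose rhs := memory_rhs F' K' fl a.
have mem_le x t c : continuous x -> S1 t -> 0 <= c -> c <= r ->
    (forall u, u <= t -> `|x u| <= c) -> `|mem x t| <= M * wt c.
  move=> cx S1t c0 cr xc; have /andP[at_ tb] := Sab _ (S1S _ S1t).
  apply: (@le_trans _ _ (D * wt c * (t - a))); last first.
    rewrite mulrC /M mulrA ler_wpM2r ?wt0//.
    by rewrite ler_wpM2r ?(ltW D0)// lerD2r.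
  have := @Rintegral_itv_approx R _ _ 0 (D * wt c) a t
    (measurable_kernel _ _ cK' mfl x t cx) (fun s => K'L _) at_.
  rewrite mul0r subr0; apply => s ast; have /andP[as_ st] := ast.
  have xs : `|x (fl s)| <= c.
    by apply: xc; rewrite (le_trans (fl_le _ as_)) ?(ltW st).
  have S2s := flS2 _ _ S1t ast.
  rewrite subr0 K'E// ?(le_trans xs)//; apply: le_trans (Kbd _ _ _ S1t S2s) _.
  by rewrite ler_wpM2l ?(ltW D0)// wtnd.
have Ml c : 0 <= c -> c <= r -> M * wt c <= l.
  by move=> c0 cr; rewrite le_max ler_wpM2l ?orbT// wtnd.
have [||x [cx xE xr]] := @tonelli_level_solution R F' K' _ _ fl a b A cF' cK'
    F'L K'L mfl fl_le H r0 N H0 _ bN.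
- by rewrite lerDr.
- move=> x k s kN cx xk /andP[as_ sb].
  have S1s : S1 (fl s) by apply: (flS1 b) => //; rewrite as_.
  pose c := r0 + k.+1%:R; have c0 : 0 <= c := rk _.
  have cr : c <= r by rewrite lerD2l ler_nat.
  have xc u : u <= fl s -> `|x u| <= c.
    by move=> us; apply: xk; exact: le_trans us (fl_le _ as_).
  have mc := mem_le _ _ _ cx S1s c0 cr xc.
  rewrite /memory_rhs F'E//; last 2 first.
  + exact: le_trans (xc _ (lexx _)) (le_trans cr rl).
  + exact: le_trans mc (Ml _ c0 cr).
  apply: le_trans (Fbd _ _ _ S1s) _.
  rewrite lerD2r ler_wpM2l ?(ltW B0)//; apply: wnd.
    by rewrite le_max normr_ge0.
  by rewrite ge_max !le_max xc//= mc orbT.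
have F'eq t : S1 t -> rhs x t = F (t, x t, mem x t).
  move=> S1t; apply: F'E => //; first exact: le_trans (xr _) rl.
  by apply: le_trans (Ml _ r_ge0 (lexx _)); exact: mem_le.
have crhs : continuous (rhs x) by exact: continuous_memory_rhs.
have xI u : u <= b -> x u = A + running_integral a (fun s => rhs x (fl s)) u.
  by move=> ub; rewrite -{1}xE /tonelli (min_idPl ub) subr0.
have dx t : S t -> is_delta_derive S x t (rhs x t).
  move=> St; apply: (is_delta_derive_integral S x (fun s => rhs x (fl s)) (rhs x)
    (B * w l + C)) => //.
  - exact: measurable_memory_rhs.
  - by move=> s; exact: F'L.
  - move=> u v Su Sv uv.
    have /andP[au ub] := Sab _ Su; have /andP[av vb] := Sab _ Sv.
    rewrite -(running_integralB a _ (B * w l + C))//; last 2 first.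
    + exact: measurable_memory_rhs.
    + by move=> s; exact: F'L.
    by rewrite !xI//; ring.
  - move=> u v s Su Sv /andP[us sv]; exists (fl s); split => //.
      by apply: fl_le; apply: le_trans us; case/andP: (Sab _ Su).
    by move=> q Sq qs; exact: le_ts_floor.
  - exact: crhs.
exists x; split.
- exists (rhs x); first by move=> t [St _]; exact: dx.
  exact: continuous_subspaceT.
- by rewrite xI ?ltW// running_integral_eq0// addr0.
move=> t S1t; exists (mem x t); last by rewrite -F'eq//; apply: dx; exact: S1S.
(* The inner integral lives on kappa S, whose floor agrees with that of S before
   any point of kappa S. *)
pose g s := K' (t, fl s, x (fl s)).
have mg : measurable_fun [set: measurableTypeR R] g.
  exact: (measurable_kernel K' fl cK' mfl).
exists (running_integral a g); last by rewrite (running_integral_eq0 a g a)// subr0.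
move=> u S2u; rewrite -K'E//.
have S1u : S1 u by exact: kappa_sub S2u.
apply: (is_delta_derive_integral S1 _ g (fun s => K' (t, s, x s)) (D * wt r + 1)) => //.
- by move=> s; exact: K'L.
- move=> p q S1p S1q pq; apply: (running_integralB a g (D * wt r + 1)) => //.
    by move=> s; exact: K'L.
  by case/andP: (Sab _ (S1S _ S1p)).
- move=> p q s S1p S1q /andP[ps sq].
  have as_ : a <= s by apply: le_trans ps; case/andP: (Sab _ (S1S _ S1p)).
  exists (fl s); split => //; first by apply: (flS1 q); rewrite ?as_//; exact: S1S.
    exact: fl_le.
  by move=> c S1c cs; apply: le_ts_floor => //; exact: S1S.
- exact: (continuous_cvg3 _ _ _ _ _ _ _ _ cK' (cvg_cst t) (@cvg_id _ (nbhs u)) (cx u)).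
Qed.
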